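(* Let $P$ be the transition matrix of a finite irreducible Markov chain with $m$ states. Define $R_0 = I - ee^T/m$ and, for $i=1,2,\dots,m$, with $p_i^T = e_i^TP$ and $b_i^T = p_i^T - e^T/m$, $$R_i = R_{i-1} + \frac{1}{1-b_i^TR_{i-1}e_i}\,R_{i-1}e_ib_i^TR_{i-1}.$$ Then this recursion is well defined (all the denominators are non-zero) and: (1) the stationary probability vector of the chain is $\pi^T = e_1^T - e_1^T(I-P)R_m$; (2) the group inverse of $A=I-P$ is $A^{\#} = (I-e\pi^T)R_m$; (3) the mean first passage time matrix of the chain is $M = [I - R_m + E(R_m)_d]D$, where $E = ee^T$ and $D = \left((e\pi^T)_d\right)^{-1}$.
   Context: All matrices are real $m\times m$; $e$ is the column vector of all ones in $\mathbb{R}^m$ and $e_i$ is the $i$-th standard basis column vector. For a square matrix $X$, $X_d$ denotes the diagonal matrix having the same diagonal entries as $X$. A transition matrix is a stochastic matrix (nonnegative entries, each row sum 1). The stationary probability vector of an irreducible $P$ is the unique row vector $\pi^T$ with $\pi^T(I-P)=0^T$, $\pi^Te=1$ (all its entries are positive). The group inverse $A^{\#}$ of $A=I-P$ is the unique matrix with $AA^{\#}A=A$, $A^{\#}AA^{\#}=A^{\#}$, $AA^{\#}=A^{\#}A$. The mean first passage time matrix is $M=[m_{ij}]$, where $m_{ij}$ is the expected value, given $X_0=i$, of $\min\{n\ge 1: X_n=j\}$ for the Markov chain $(X_n)_{n\ge 0}$ with transition matrix $P=[p_{ij}]$; for finite irreducible chains these are finite and $M$ is the unique matrix satisfying $m_{ij}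 = 1+\sum_{k\neq j}p_{ik}m_{kj}$ for all $i,j$. *)

(* Defs.v *)
(* MathComp / MathComp-Analysis, over an arbitrary R : realType. *)
From HB Require Import structures.
From mathcomp Require Import all_boot all_order all_algebra.
From mathcomp Require Import all_classical all_reals all_analysis.

Set Implicit Arguments.
Unset Strict Implicit.
Unset Printing Implicit Defensive.

Import Order.TTheory GRing.Theory Num.Theory.
Local Open Scope classical_set_scope.
Local Open Scope ring_scope.

(* The number of states is m = n.+1, and the states 1, ..., m are the ordinals
   0, ..., n of 'I_n.+1. *)

Definition stochastic (R : realType) (n : nat) (P : 'M[R]_n.+1) : Prop :=
  (forall i j, 0 <= P i j) /\ (forall i, \sum_j P i j = 1).

Definition irreducible_chain (R : realType) (n : nat) (P : 'M[R]_n.+1) : Prop :=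
  forall i j, exists k : nat, 0 < (P ^+ k) i j.

Definition ones (R : realType) (n : nat) : 'cV[R]_n.+1 := const_mx 1.

Definition basis_vec (R : realType) (n : nat) (i : 'I_n.+1) : 'cV[R]_n.+1 :=
  delta_mx i 0.

Definition diag_part (R : realType) (n : nat) (X : 'M[R]_n.+1) : 'M[R]_n.+1 :=
  diag_mx (\row_i X i i).

Definition stationary (R : realType) (n : nat) (P : 'M[R]_n.+1)
    (pi : 'rV[R]_n.+1) : Prop :=
  pi *m (1%:M - P) = 0 /\ pi *m ones R n = 1%:M.

Definition group_inverse (R : realType) (n : nat) (A G : 'M[R]_n.+1) : Prop :=
  [/\ A *m G *m A = A, G *m A *m G = G & A *m G = G *m A].

(* The Markov property is multiplied out, so that it makes sense (and is
   automatic) for histories of probability zero. *)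
Definition markov_chain (R : realType) (n : nat) (P : 'M[R]_n.+1)
    (d : measure_display) (T : measurableType d) (mu : probability T R)
    (X : nat -> T -> 'I_n.+1) : Prop :=
  (forall k i, measurable [set w | X k w = i]) /\
  (forall (k : nat) (x : nat -> 'I_n.+1),
     mu [set w | forall l, (l <= k.+1)%N -> X l w = x l] =
     (mu [set w | forall l, (l <= k)%N -> X l w = x l]
        * (P (x k) (x k.+1))%:E)%E).

(* min {k >= 1 : X_k = j}, equal to +oo when j is never reached. *)
Definition first_passage_time (R : realType) (n : nat) (T : Type)
    (X : nat -> T -> 'I_n.+1) (j : 'I_n.+1) (w : T) : \bar R :=
  ereal_inf [set (k%:R)%:E | k in [set k : nat | (0 < k)%N /\ X k w = j]].

Definition cond_expectation (R : realType) (d : measure_display)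
    (T : measurableType d) (mu : probability T R) (A : set T)
    (f : T -> \bar R) : \bar R :=
  (((fine (mu A))^-1)%:E * \int[mu]_(w in A) f w)%E.

(* M i j is the expected first passage time to j given X_0 = i, for every
   chain with transition matrix P, whatever its probability space and its
   initial distribution (as long as X_0 = i has positive probability). *)
Definition mean_first_passage (R : realType) (n : nat) (P M : 'M[R]_n.+1) :
    Prop :=
  forall (d : measure_display) (T : measurableType d) (mu : probability T R)
         (X : nat -> T -> 'I_n.+1),
    markov_chain P mu X ->
    forall i j, (0 < mu [set w | X 0%N w = i])%E ->
      cond_expectation mu [set w | X 0%N w = i] (first_passage_time R X j) =
      (M i j)%:E.

Definition bT (R : realType) (n : nat) (P : 'M[R]_n.+1) (i : 'I_n.+1) :
    'rV[R]_n.+1 :=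
  (basis_vec R i)^T *m P - (n.+1)%:R^-1 *: (ones R n)^T.

Definition denom (R : realType) (n : nat) (P S : 'M[R]_n.+1) (i : 'I_n.+1) :
    R :=
  1 - (bT P i *m S *m basis_vec R i) 0 0.

(* The step from Rseq P k to Rseq P k.+1 uses the ordinal of value k, i.e. the
   (k+1)-st state; only k <= n.+1 is meaningful. *)
Fixpoint Rseq (R : realType) (n : nat) (P : 'M[R]_n.+1) (k : nat) :
    'M[R]_n.+1 :=
  match k with
  | 0%N => 1%:M - (n.+1)%:R^-1 *: (ones R n *m (ones R n)^T)
  | k'.+1 =>
      let S := Rseq P k' in
      let i : 'I_n.+1 := inord k' in
      S + (denom P S i)^-1 *: (S *m basis_vec R i *m bT P i *m S)
  end.

(* Main.v *)
Require Import Defs.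
From HB Require Import structures.
From mathcomp Require Import all_boot all_order all_algebra.
From mathcomp Require Import all_classical all_reals all_analysis.
From mathcomp Require Import measurable_realfun.

(** Write [J = e e^T / m] and let [P_k] have the first [k] rows of [P] and all
    other rows equal to [e^T / m], so that [P_(k+1) = P_k + e_(k+1) b_(k+1)^T].
    The matrices [W_k = I - (I - J) P_k] are invertible by the maximum principle
    and differ by rank-one updates, so the Sherman-Morrison formula gives
    [R_k = W_k^-1 - J].  For [k = m] this yields [R_m A = I - J] and
    [A R_m = I - e pi], from which (1), (2) and the equations
    [M = E + P (M - M_d)] for the matrix of (3) follow by computation.
    If [Q] is [P] with its column [j] set to zero, then
    [Pr (X_0 = i, T_j > k) = Pr (X_0 = i) (Q^k e)_i], so the expected passage
    time is [sum_k (Q^k e)_i], which is the [j]-th column of any solution [M]. *)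

Set Implicit Arguments.
Unset Strict Implicit.
Unset Printing Implicit Defensive.

Import Order.TTheory GRing.Theory Num.Theory.
Import numFieldNormedType.Exports.
Local Open Scope ring_scope.

(** * Linear algebra: rank-one updates and diagonal inverses *)

Lemma unitmx_of_ker0 (F : fieldType) (n : nat) (W : 'M[F]_n) :
  (forall x : 'cV_n, W *m x = 0 -> x = 0) -> W \in unitmx.
Proof.
move=> W0; rewrite -unitmx_tr -row_free_unit; apply: inj_row_free => v vW.
by apply: trmx_inj; rewrite trmx0; apply: W0; apply: trmx_inj;
  rewrite trmx_mul trmxK vW trmx0.
Qed.

Lemma mulmx_rank1 (F : fieldType) (n : nat) (c : 'cV[F]_n) (b : 'rV[F]_n)
    (x : 'cV[F]_n) : c *m b *m x = (b *m x) 0 0 *: c.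
Proof. by rewrite -mulmxA {1}[b *m x]mx11_scalar mul_mx_scalar. Qed.

(** If the denominator vanished, [W^-1 c] would lie in the kernel of [W - c b]; then [c = 0], which
    makes the denominator 1. *)
Lemma sherman_morrison_denom (F : fieldType) (n : nat) (W : 'M[F]_n)
    (c : 'cV[F]_n) (b : 'rV[F]_n) :
  W \in unitmx -> W - c *m b \in unitmx -> 1 - (b *m invmx W *m c) 0 0 != 0.
Proof.
move=> Wu Vu; apply/eqP => d0.
have : (W - c *m b) *m (invmx W *m c) = 0.
  by rewrite mulmxBl mulKVmx // mulmx_rank1 mulmxA -[X in X - _]scale1r -scalerBl d0 scale0r.
move/(congr1 (mulmx (invmx (W - c *m b)))); rewrite mulKmx // mulmx0.
move/(congr1 (mulmx W)).
rewrite mulKVmx // mulmx0 => c0; move: d0; rewrite c0 mulmx0 mxE subr0.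
by apply/eqP; exact: oner_neq0.
Qed.

Lemma sherman_morrison (F : fieldType) (n : nat) (W : 'M[F]_n)
    (c : 'cV[F]_n) (b : 'rV[F]_n) :
  W \in unitmx -> W - c *m b \in unitmx ->
  invmx (W - c *m b) =
  invmx W + (1 - (b *m invmx W *m c) 0 0)^-1 *: (invmx W *m c *m b *m invmx W).
Proof.
move=> Wu Vu; have d0 := sherman_morrison_denom Wu Vu.
set d := 1 - _ in d0 *.
suff VN : (W - c *m b) *m (invmx W + d^-1 *: (invmx W *m c *m b *m invmx W)) = 1%:M.
  by rewrite -[LHS]mulmx1 -VN mulKmx.
rewrite mulmxDr -scalemxAr mulmxBl mulmxV // -!mulmxA mulmxBl mulKVmx //.
rewrite (mulmxA (c *m b)) (mulmxA (c *m b *m _)).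
rewrite -(mulmxA (c *m b) (invmx W) c) mulmx_rank1 -scalemxAl.
rewrite -[X in d^-1 *: (X - _)]scale1r -scalerBl [b *m (_ *m c)]mulmxA -/d mulmxA.
by rewrite scalerA mulVf // scale1r addrNK.
Qed.

Lemma invmx_diag_mx (F : fieldType) (n : nat) (d : 'rV[F]_n) : (forall i, d 0 i != 0) ->
  invmx (diag_mx d) = diag_mx (\row_i (d 0 i)^-1).
Proof.
move=> d0; have du : diag_mx d \in unitmx.
  by rewrite unitmxE det_diag unitfE; apply/prodf_neq0.
apply: (can_inj (mulKmx du)); rewrite mulmxV // mulmx_diag.
by rewrite -diag_const_mx; congr diag_mx; apply/rowP => i; rewrite !mxE mulfV.
Qed.

(** * Maximum principle for irreducible chains *)

Section MaxPrinciple.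
Variables (R : realType) (n : nat).
Implicit Types (P : 'M[R]_n.+1) (x : 'cV[R]_n.+1).

Lemma expmx_ge0 P k : (forall i j, 0 <= P i j) -> forall i j, 0 <= (P ^+ k) i j.
Proof.
move=> P0; elim: k => [|k IH] i j; first by rewrite expr0 mxE ler0n.
by rewrite exprS mxE; apply: sumr_ge0 => u _; rewrite mulr_ge0.
Qed.

(** Induction on the length of a path of positive probability from [s] to [t]: a positive term of
    [(P * P^k) s t] provides a first step, which stays in [C]. *)
Lemma irreducible_closed P (C : pred 'I_n.+1) (s : 'I_n.+1) :
  (forall i j, 0 <= P i j) -> irreducible_chain P ->
  (forall i j, C i -> 0 < P i j -> C j) -> C s -> forall t, C t.
Proof.
move=> P0 irr clC Cs t; have [k] := irr s t.
elim: k s Cs => [|k IH] s Cs.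
  by rewrite expr0 mxE; case: eqP => [<-//|_]; rewrite mulr0n ltxx.
rewrite exprS mxE => /lt0r_neq0/eqP.
have Pk0 := expmx_ge0 k P0.
move=> /(psumr_neq0P (fun u _ => mulr_ge0 (P0 s u) (Pk0 u t)))[u /= PPk].
have Psu : 0 < P s u by rewrite lt_neqAle P0 andbT;
  apply: contraTneq PPk => <-; rewrite mul0r ltxx.
by apply: IH (clC _ _ Cs Psu) _; rewrite -(pmulr_rgt0 _ Psu).
Qed.

(** The equation at a minimum of [x] gives [c <= 0], at a maximum [c >= 0]. With [c = 0], the set of
    maximisers is closed under the steps of [V]. If a maximiser has a strictly positive row, every
    state is a maximiser at once; otherwise the set is closed under the steps of [P], and
    irreducibility applies. *)
Lemma max_principle P (V : 'M[R]_n.+1) x (c : R) :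
  stochastic P -> irreducible_chain P -> stochastic V ->
  (forall i, (forall j, V i j = P i j) \/ (forall j, 0 < V i j)) ->
  x - V *m x = c *: ones R n -> exists a, x = a *: ones R n.
Proof.
move=> [P0 P1] irr [V0 V1] VP Vx.
have xE i : x i 0 - \sum_j V i j * x j 0 = c.
  by move/matrixP/(_ i 0): Vx; rewrite !mxE mulr1.
have cE i : c = \sum_j V i j * (x i 0 - x j 0).
  under eq_bigr do rewrite mulrBr.
  by rewrite big_split /= -mulr_suml V1 mul1r sumrN -(xE i).
have [s _ smax] := @arg_maxP _ _ _ ord0 xpredT (fun i => x i 0) isT.
have [r _ rmin] := @arg_minP _ _ _ ord0 xpredT (fun i => x i 0) isT.
have c0 : c = 0.
  apply/eqP; rewrite eq_le {1}(cE r) (cE s) -oppr_ge0 -sumrN; apply/andP; split.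
    by apply: sumr_ge0 => j _; rewrite -mulrN opprB mulr_ge0 // subr_ge0 rmin.
  by apply: sumr_ge0 => j _; rewrite mulr_ge0 // subr_ge0; apply: smax.
pose C := [pred i | x i 0 == x s 0].
have clC i j : C i -> 0 < V i j -> C j.
  move=> /eqP xis Vij; have := cE i; rewrite c0 => /esym/psumr_eq0P e0.
  have /eqP : V i j * (x i 0 - x j 0) = 0.
    by apply: e0 => // k _; rewrite mulr_ge0 // xis subr_ge0; apply: smax.
  by rewrite mulf_eq0 gt_eqF //= subr_eq0 xis eq_sym.
have Cs : C s by rewrite /C /=.
have Call j : C j.
  have [[i [Ci Vi]]|noV] := pselect (exists i, C i /\ forall j, 0 < V i j).
    exact: clC Ci (Vi j).
  apply: irreducible_closed P0 irr _ Cs j => i j Ci; case: (VP i) => [<-|Vi].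
    exact: clC.
  by case: noV; exists i.
exists (x s 0); apply/matrixP => i j; rewrite !mxE mulr1 ord1.
by have /eqP := Call i.
Qed.

End MaxPrinciple.

(** * The matrices [W_k] and the recursion for [R_k] *)

Section Recursion.
Variables (R : realType) (n : nat) (P : 'M[R]_n.+1).
Hypotheses (Pst : stochastic P) (Pirr : irreducible_chain P).

Local Notation e := (ones R n).
Local Notation avg := (n.+1%:R^-1 *: (e *m e^T)).
Local Notation A := (1%:M - P).

Definition partial_chain (k : nat) : 'M[R]_n.+1 :=
  \matrix_(i, j) if (i < k)%N then P i j else n.+1%:R^-1.

(** This is [W_k]. The factor [I - J] makes [e] a right and [e^T] a left eigenvector for the
    eigenvalue 1, so that [J] absorbs [W_k^-1] on either side. *)
Definition fundamental_inv (k : nat) : 'M[R]_n.+1 :=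
  1%:M - (1%:M - avg) *m partial_chain k.

Lemma avgE i j : avg i j = n.+1%:R^-1.
Proof. by rewrite !mxE big_ord1 !mxE mulr1 mulr1. Qed.

Lemma stochastic_ones (V : 'M[R]_n.+1) : stochastic V -> V *m e = e.
Proof.
move=> [_ V1]; apply/matrixP => i j; rewrite !mxE -[RHS](V1 i).
by apply: eq_bigr => k _; rewrite mxE mulr1.
Qed.

Lemma sum_inv : \sum_(j < n.+1) (n.+1%:R^-1 : R) = 1.
Proof. by rewrite sumr_const card_ord -[LHS]mulr_natl divff // pnatr_eq0. Qed.

Lemma avg_stochastic : stochastic (avg : 'M[R]_n.+1).
Proof.
split=> [i j|i]; first by rewrite avgE invr_ge0.
by under eq_bigr do rewrite avgE; apply: sum_inv.
Qed.

Lemma partial_stochastic k : stochastic (partial_chain k).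
Proof.
have [P0 P1] := Pst; split=> [i j|i].
  by rewrite mxE; case: ifP => // _; rewrite invr_ge0.
under eq_bigr do rewrite mxE.
by case: (i < k)%N => //; apply: sum_inv.
Qed.

Lemma avg_ones : avg *m e = e.
Proof. exact/stochastic_ones/avg_stochastic. Qed.

Lemma tr_avg : avg^T = avg :> 'M[R]_n.+1.
Proof. by apply/matrixP => i j; rewrite mxE !avgE. Qed.

Lemma ones_avg : e^T *m avg = e^T.
Proof. by rewrite -tr_avg -trmx_mul avg_ones. Qed.

Lemma avg_idem : avg *m avg = avg :> 'M[R]_n.+1.
Proof. by rewrite -scalemxAr mulmxA avg_ones. Qed.

Lemma avg_mul (x : 'cV[R]_n.+1) : avg *m x = (n.+1%:R^-1 * (e^T *m x) 0 0) *: e.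
Proof. by rewrite -scalemxAl mulmx_rank1 scalerA. Qed.

(** If [W_k x = 0], then [x = (I - J) P_k x], so [e^T x = 0] and [x - P_k x] is a multiple of [e].
    By the maximum principle [x] is constant, and a constant vector of mean zero is zero. *)
Lemma fundamental_inv_unit k : fundamental_inv k \in unitmx.
Proof.
apply: unitmx_of_ker0 => x.
rewrite mulmxBl mul1mx -mulmxA => /eqP; rewrite subr_eq0 => /eqP xE.
set y := partial_chain k *m x in xE.
have ex : e^T *m x = 0 by rewrite xE mulmxA mulmxBr mulmx1 ones_avg subrr mul0mx.
have : x - y = - (n.+1%:R^-1 * (e^T *m y) 0 0) *: e.
  by rewrite {1}xE mulmxBl mul1mx avg_mul scaleNr addrAC subrr add0r.
case/(max_principle Pst Pirr (partial_stochastic k)).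
  (* The first [k] rows agree with [P]; the remaining uniform rows are strictly positive. *)
  move=> i; case: (ltnP i k) => ik; [left|right] => j; rewrite mxE ?ik //.
  by rewrite ltnNge ik /= invr_gt0 ltr0Sn.
move=> a xa; rewrite xa.
have: avg *m x = 0 by rewrite avg_mul ex mxE mulr0 scale0r.
by rewrite xa -scalemxAr avg_ones.
Qed.

Lemma bTE i : bT P i = row i (P - avg).
Proof.
by rewrite /bT /basis_vec trmx_delta -rowE; apply/rowP => j; rewrite !mxE big_ord1 !mxE !mulr1.
Qed.

(** Both [p_i^T] and [e^T / m] have sum 1, so [b_i^T e = 0]. *)
Lemma bT_avg i : bT P i *m avg = 0.
Proof.
rewrite bTE -row_mul mulmxBl avg_idem -scalemxAr mulmxA (stochastic_ones Pst).
by rewrite subrr row0.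
Qed.

Lemma partial_chainS (i : 'I_n.+1) :
  partial_chain i.+1 = partial_chain i + basis_vec R i *m bT P i.
Proof.
apply/matrixP => u v; rewrite bTE 2!mxE [(_ *m _) u v]mxE big_ord1 !mxE eqxx andbT.
rewrite big_ord1 !mxE !mulr1.
case: (eqVneq u i) => [->|ui]; first by rewrite ltnSn ltnn mul1r addrCA subrr addr0.
by rewrite mul0r addr0 ltnS leq_eqVlt val_eqE (negbTE ui).
Qed.

Lemma fundamental_invS (i : 'I_n.+1) :
  fundamental_inv i.+1 =
  fundamental_inv i - (1%:M - avg) *m basis_vec R i *m bT P i.
Proof. by rewrite /fundamental_inv partial_chainS mulmxDr opprD addrA mulmxA. Qed.

Lemma fundamental_inv_ones k : fundamental_inv k *m e = e.
Proof.
rewrite mulmxBl mul1mx -mulmxA (stochastic_ones (partial_stochastic k)).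
by rewrite mulmxBl mul1mx avg_ones subrr subr0.
Qed.

Lemma ones_fundamental_inv k : e^T *m fundamental_inv k = e^T.
Proof. by rewrite mulmxBr mulmx1 mulmxA mulmxBr mulmx1 ones_avg subrr mul0mx subr0. Qed.

Lemma fundamental_avg k : invmx (fundamental_inv k) *m avg = avg.
Proof.
have Wavg : fundamental_inv k *m avg = avg.
  by rewrite -scalemxAr mulmxA fundamental_inv_ones.
by rewrite -{1}Wavg mulKmx // fundamental_inv_unit.
Qed.

Lemma avg_fundamental k : avg *m invmx (fundamental_inv k) = avg.
Proof.
have avgW : avg *m fundamental_inv k = avg.
  by rewrite -scalemxAl -mulmxA ones_fundamental_inv.
by rewrite -{1}avgW mulmxK // fundamental_inv_unit.
Qed.

(** Since [N J = J] and [b_i^T J = 0], all corrections by [J] vanish: the denominator of the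
    recursion is the Sherman-Morrison denominator for the update of [W_k]. *)
Lemma bT_fundamental_denom (i : 'I_n.+1) k (N := invmx (fundamental_inv k)) :
  denom P (N - avg) i = 1 - (bT P i *m N *m ((1%:M - avg) *m basis_vec R i)) 0 0.
Proof.
congr (1 - fun_of_matrix _ 0 0); rewrite mulmxA [in LHS]mulmxBr bT_avg.
by rewrite [in RHS]mulmxBr mulmx1 -[in RHS]mulmxA fundamental_avg bT_avg.
Qed.

Lemma Rseq_fundamental k : (k <= n.+1)%N ->
  Rseq P k = invmx (fundamental_inv k) - avg.
Proof.
elim: k => [|k IH] kn.
  (* [P_0 = J] and [(I - J) J = 0], hence [W_0 = I]. *)
  have -> : fundamental_inv 0 = 1%:M.
    have -> : fundamental_inv 0 = 1%:M - (1%:M - avg) *m avg.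
      by congr (_ - _ *m _); apply/matrixP => i j; rewrite avgE mxE.
    by rewrite mulmxBl mul1mx avg_idem subrr subr0.
  by rewrite invmx1.
rewrite /= (IH (ltnW kn)); set i := inord k : 'I_n.+1.
(* The bound [kn] ensures that [inord k] really is the state of value [k], not a default. *)
have ik : i = k :> nat by rewrite inordK.
have Wk : fundamental_inv k.+1 =
    fundamental_inv k - (1%:M - avg) *m basis_vec R i *m bT P i.
  by rewrite -ik fundamental_invS.
rewrite bT_fundamental_denom Wk sherman_morrison -?Wk ?fundamental_inv_unit //.
rewrite [RHS]addrAC; congr (_ - _ + _ *: _).
set N := invmx _.
(* The outer factors agree too: [N (I - J) = N - J] on the left, [b_i^T (N - J) = b_i^T N] on the
   right. *)
have -> : N - avg = N *m (1%:M - avg) by rewrite mulmxBr mulmx1 fundamental_avg.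
rewrite -!mulmxA; congr (_ *m (_ *m (_ *m _))).
by rewrite mulmxBr mulmx1 fundamental_avg mulmxBr bT_avg subr0.
Qed.

Lemma denom_neq0 (i : 'I_n.+1) : denom P (Rseq P i) i != 0.
Proof.
rewrite Rseq_fundamental ?(ltnW (ltn_ord i)) // bT_fundamental_denom.
apply: sherman_morrison_denom; first exact: fundamental_inv_unit.
by rewrite -fundamental_invS fundamental_inv_unit.
Qed.

(** * The final matrix [R_m]: stationary vector, group inverse, positivity *)

Local Notation Rm := (Rseq P n.+1).
Local Notation e1 := (basis_vec R (ord0 : 'I_n.+1)).
Local Notation pi := (e1^T - e1^T *m A *m Rm).

Lemma partial_chain_full : partial_chain n.+1 = P.
Proof. by apply/matrixP => i j; rewrite mxE ltn_ord. Qed.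

Lemma A_ones : A *m e = 0.
Proof. by rewrite mulmxBl mul1mx stochastic_ones // subrr. Qed.

Lemma A_avg : A *m avg = 0.
Proof. by rewrite -scalemxAr mulmxA A_ones mul0mx scaler0. Qed.

Lemma Rm_ones : Rm *m e = 0.
Proof.
rewrite Rseq_fundamental // mulmxBl avg_ones.
by rewrite -{1}(fundamental_inv_ones n.+1) mulKmx ?fundamental_inv_unit // subrr.
Qed.

Lemma avg_Rm : avg *m Rm = 0.
Proof. by rewrite Rseq_fundamental // mulmxBr avg_fundamental avg_idem subrr. Qed.

(** With [N = W_m^-1], one has [R_m = N (I - J)] and [(I - J) A = W_m - J], so the product is
    [N W_m - N J]. *)
Lemma Rm_A : Rm *m A = 1%:M - avg.
Proof.
have NA : (1%:M - avg) *m A = fundamental_inv n.+1 - avg.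
  by rewrite mulmxBr mulmx1 /fundamental_inv partial_chain_full addrAC.
rewrite Rseq_fundamental // -[X in _ - X](fundamental_avg n.+1).
rewrite -[X in X - _]mulmx1 -mulmxBr -mulmxA NA mulmxBr fundamental_avg mulVmx //.
exact: fundamental_inv_unit.
Qed.

(** The kernel of [R_m] consists of constant vectors: [N X = J X = N J X], and [N] is invertible. *)
Lemma Rm_ker0 m (X : 'M[R]_(n.+1, m)) : Rm *m X = 0 -> X = avg *m X.
Proof.
rewrite Rseq_fundamental // mulmxBl => /eqP; rewrite subr_eq0 => /eqP NX.
rewrite -[LHS](mulKVmx (fundamental_inv_unit n.+1)) NX -{1}(fundamental_avg n.+1).
by rewrite -mulmxA mulKVmx ?fundamental_inv_unit.
Qed.

(** [R_m (I - A R_m) = R_m - (I - J) R_m = J R_m = 0], so the columns of [I - A R_m] are constant,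
    that is, its rows are all equal. By definition [pi] is its first row. *)
Lemma A_Rm : A *m Rm = 1%:M - e *m pi.
Proof.
have /Rm_ker0 avgX : Rm *m (1%:M - A *m Rm) = 0.
  by rewrite mulmxBr mulmx1 mulmxA Rm_A mulmxBl mul1mx avg_Rm subr0 subrr.
suff -> : e *m pi = 1%:M - A *m Rm by rewrite subKr.
have piE : pi = row 0 (1%:M - A *m Rm).
  by rewrite rowE [RHS]mulmxBr mulmx1 [X in _ = _ - X]mulmxA trmx_delta.
have rowX i : row i (1%:M - A *m Rm) = n.+1%:R^-1 *: (e^T *m (1%:M - A *m Rm)).
  rewrite {1}avgX row_mul [RHS]scalemxAl; congr (_ *m _).
  by apply/rowP => j; rewrite mxE avgE !mxE mulr1.
apply/row_matrixP => i; rewrite row_mul piE !rowX.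
rewrite (_ : row i e = 1%:M) ?mul1mx //.
by apply/matrixP => u v; rewrite !mxE !ord1.
Qed.

Lemma pi_A : pi *m A = 0.
Proof.
have ARA : A *m (Rm *m A) = A by rewrite Rm_A mulmxBr A_avg mulmx1 subr0.
by rewrite [LHS]mulmxBl -[X in _ - X]mulmxA -[X in _ - X]mulmxA ARA subrr.
Qed.

Lemma pi_ones : pi *m e = 1%:M.
Proof.
rewrite mulmxBl -!mulmxA Rm_ones !mulmx0 subr0 trmx_delta -rowE.
by apply/matrixP => i j; rewrite !mxE !ord1.
Qed.

(** Multiplying [A R_m = I - e pi] by [q] on the left gives [0 = q - pi]. *)
Lemma stationary_unique (q : 'rV[R]_n.+1) : stationary P q -> q = pi.
Proof.
move=> [qA qe]; move/(congr1 (mulmx q)): A_Rm.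
rewrite mulmxA qA mul0mx mulmxBr mulmx1 mulmxA qe mul1mx => /esym/eqP.
by rewrite subr_eq0 => /eqP.
Qed.

Lemma stationary_pi : stationary P pi.
Proof. by split; [exact: pi_A | exact: pi_ones]. Qed.

(** Both products of [A] with the candidate equal the idempotent [I - e pi]; the three axioms follow
    from [pi A = 0] and [pi e = 1]. *)
Lemma group_inverse_Rm : group_inverse A ((1%:M - e *m pi) *m Rm).
Proof.
have [pA pe] := stationary_pi; have AR := A_Rm.
move: pA pe AR; set p := pi => pA pe AR.
have AG : A *m ((1%:M - e *m p) *m Rm) = 1%:M - e *m p.
  by rewrite mulmxA mulmxBr mulmx1 mulmxA A_ones mul0mx subr0 AR.
have GA : (1%:M - e *m p) *m Rm *m A = 1%:M - e *m p.
  rewrite -mulmxA Rm_A mulmxBr mulmx1 mulmxBl mul1mx -scalemxAr.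
  by rewrite (mulmxA (e *m p)) -(mulmxA e p) pe mulmx1 subrr subr0.
split; last by rewrite AG GA.
  by rewrite AG mulmxBl mul1mx -mulmxA pA mulmx0 subr0.
rewrite GA mulmxA; congr (_ *m _).
rewrite mulmxBr mulmx1 mulmxBl mul1mx (mulmxA (e *m p)) -(mulmxA e p) pe.
by rewrite mulmx1 subrr subr0.
Qed.

(* [|pi| P >= |pi|] entrywise with equal total mass, so [|pi|] is also invariant. *)
Lemma pi_ge0 j : 0 <= pi 0 j.
Proof.
have [P0 P1] := Pst; have [pA pe] := stationary_pi.
move: pA pe (@stationary_unique); move: (pi) => p pA pe uniq.
have pP i : \sum_k p 0 k * P k i = p 0 i.
  move: pA; rewrite mulmxBr mulmx1 => /eqP; rewrite subr_eq0 => /eqP/matrixP/(_ 0 i).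
  by rewrite mxE => <-.
have p1 : \sum_k p 0 k = 1.
  have := congr1 (fun X : 'M[R]_1 => X 0 0) pe; rewrite !mxE eqxx mulr1n => <-.
  by apply: eq_bigr => k _; rewrite mxE mulr1.
pose q i := `|p 0 i|; have qle i : q i <= \sum_k q k * P k i.
  rewrite /q -{1}pP; apply: le_trans (ler_norm_sum _ _ _) _.
  by apply: ler_sum => k _; rewrite normrM (ger0_norm (P0 k i)).
have qsum : \sum_i (\sum_k q k * P k i - q i) = 0.
  rewrite sumrB exchange_big /= -sumrB big1 // => k _.
  by rewrite -mulr_sumr P1 mulr1 subrr.
have qP i : \sum_k q k * P k i = q i.
  by apply/eqP; rewrite -subr_eq0; apply/eqP/(psumr_eq0P _ qsum) => // k _; rewrite subr_ge0.
have q1 : 1 <= \sum_k q k by rewrite -p1; apply: ler_sum => k _; exact: ler_norm.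
have q0 : 0 < \sum_k q k := lt_le_trans ltr01 q1.
rewrite -(uniq ((\sum_k q k)^-1 *: \row_k q k)); last split.
- by rewrite !mxE mulr_ge0 ?invr_ge0 ?(ltW q0) // /q.
- rewrite -scalemxAl mulmxBr mulmx1; apply/matrixP => u i; rewrite !mxE.
  by under [X in _ * (_ - X)] eq_bigr do rewrite mxE; rewrite qP subrr mulr0.
- apply/matrixP => u i; rewrite !ord1 -scalemxAl !mxE eqxx.
  by under [X in _ * X] eq_bigr do rewrite !mxE mulr1; rewrite mulVf ?gt_eqF.
Qed.

(** Some [pi_i] is positive because the total is 1, and [pi = pi P^k] carries this mass to [j] along
    a path from [i]. *)
Lemma pi_gt0 j : 0 < pi 0 j.
Proof.
have [P0 P1] := Pst; have [pA pe] := stationary_pi.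
move: pA pe (pi_ge0); move: (pi) => p pA pe p0.
have pP : p *m P = p.
  by move: pA; rewrite mulmxBr mulmx1 => /eqP; rewrite subr_eq0 => /eqP.
have pPk k : p *m P ^+ k = p.
  elim: k => [|k IH]; first by rewrite expr0 mulmx1.
  by rewrite exprS mulmxA pP.
have : (p *m e) 0 0 <> 0 by rewrite pe mxE; apply/eqP; exact: oner_neq0.
rewrite mxE => /psumr_neq0P[|i /=]; first by move=> i _; rewrite mxE mulr1.
rewrite mxE mulr1 => pi0; have [k Pk] := Pirr i j.
rewrite -(pPk k) mxE (bigD1 i) //= ltr_pwDl ?mulr_gt0 // sumr_ge0 // => u _.
by rewrite mulr_ge0 // expmx_ge0.
Qed.

(** * The linear equations of the mean first passage matrix *)

Lemma diag_part_pi : diag_part (e *m pi) = diag_mx pi.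
Proof.
rewrite /diag_part; congr diag_mx; apply/rowP => i; rewrite [LHS]mxE.
by rewrite mxE big_ord1 [const_mx _ _ _]mxE mul1r.
Qed.

Lemma diag_part_pi_unit : diag_part (e *m pi) \in unitmx.
Proof.
rewrite diag_part_pi unitmxE det_diag unitfE; apply/prodf_neq0 => i _.
by rewrite gt_eqF // pi_gt0.
Qed.

Local Notation D := (invmx (diag_part (e *m pi))).
Local Notation M := ((1%:M - Rm + e *m e^T *m diag_part Rm) *m D).

(** Row by row, [E (R_m)_d] repeats the diagonal of [R_m], so the bracket has unit diagonal. This is
    Kac's formula [m_jj = 1 / pi_j]. *)
Lemma diag_part_M : diag_part M = D.
Proof.
rewrite diag_part_pi invmx_diag_mx; last by move=> i; rewrite gt_eqF // pi_gt0.
congr diag_mx; apply/rowP => i; rewrite mul_mx_diag mxE mxE -[RHS]mul1r; congr (_ * _).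
move: Rm => X.
by rewrite mul_mx_diag !mxE big_ord1 !mxE eqxx mulr1 mul1r mulr1n subrK.
Qed.

(** As [A E = 0] and [e pi D = E], one gets [A M = (A - I + e pi) D = E - P D], and [D = M_d]. *)
Lemma mean_passage_equation : M = e *m e^T + P *m (M - diag_part M).
Proof.
have pE : e *m pi *m D = e *m e^T.
  rewrite diag_part_pi -mulmxA; congr (_ *m _).
  rewrite -[RHS](mulmxK diag_part_pi_unit) diag_part_pi; congr (_ *m _).
  by apply/rowP => i; rewrite mul_mx_diag !mxE mul1r.
have AM : A *m M = e *m e^T - P *m D.
  rewrite mulmxA mulmxDr mulmxBr mulmx1 !mulmxA A_ones !mul0mx addr0 A_Rm.
  by rewrite opprB [X in X *m D]addrC addrA subrK mulmxBl pE.
rewrite diag_part_M; move: M AM => Z AM.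
by rewrite [X in _ + X]mulmxBr addrCA -AM [(1%:M - P) *m Z]mulmxBl mul1mx addrC subrK.
Qed.

End Recursion.

(** * Finite additivity over the fibres of a finite-valued map *)

Section Fibers.
Local Open Scope classical_set_scope.
Context d (T : measurableType d) (R : realType) (mu : probability T R).

Lemma measure_fibers (F : finType) (f : T -> F) (S : pred F) (B : set T) :
  measurable B -> (forall x, measurable [set w | f w = x]) ->
  mu (B `&` [set w | S (f w)]) = (\sum_(x | S x) mu (B `&` [set w | f w = x]))%E.
Proof.
move=> mB mf.
have -> : B `&` [set w | S (f w)] =
    \bigcup_(x in [set` enum S]) (B `&` [set w | f w = x]).
  apply/seteqP; split=> w /=.
    by move=> [Bw Sw]; exists (f w) => //=; rewrite mem_enum.
  by move=> [x /=]; rewrite mem_enum => Sx [Bw fx]; rewrite fx.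
rewrite measure_fin_bigcup //.
- by rewrite -fsbig_seq ?enum_uniq // big_enum.
- by move=> x y _ _ [w /= [[_ <-] [_ <-]]].
- by move=> x _; apply: measurableI.
Qed.

End Fibers.

(** * Path events, taboo probabilities and the passage time *)

Section Hitting.
Local Open Scope classical_set_scope.
Variables (R : realType) (n : nat) (P : 'M[R]_n.+1).
Context d (T : measurableType d) (mu : probability T R).
Variable X : nat -> T -> 'I_n.+1.
Hypothesis XP : markov_chain P mu X.

(** Paths up to time [k] form a finite type, so events about the past are predicates on it and their
    measures are finite sums. *)
Definition history (k : nat) (w : T) : {ffun 'I_k.+1 -> 'I_n.+1} :=
  [ffun l : 'I_k.+1 => X l w].

Lemma history_fiber k (x : {ffun 'I_k.+1 -> 'I_n.+1}) :
  [set w | history k w = x] =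
  [set w | forall l, (l <= k)%N -> X l w = x (inord l)].
Proof.
apply/seteqP; split=> w /=; first by move=> <- l lk; rewrite ffunE inordK.
by move=> xE; apply/ffunP => l; rewrite ffunE xE ?inord_val // -ltnS.
Qed.

Lemma measurable_history k (x : {ffun 'I_k.+1 -> 'I_n.+1}) :
  measurable [set w | history k w = x].
Proof.
have [mX _] := XP.
rewrite (_ : [set w | _] =
    \bigcap_(l in [set l | (l <= k)%N]) [set w | X l w = x (inord l)]).
  by apply: bigcap_measurable => [|l _]; [exists 0%N | exact: mX].
by rewrite history_fiber.
Qed.

Lemma measurable_history_pred k (S : pred {ffun 'I_k.+1 -> 'I_n.+1}) :
  measurable [set w | S (history k w)].
Proof.
rewrite (_ : [set w | _] =
    \bigcup_(x in [set` enum S]) [set w | history k w = x]).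
  apply: fin_bigcup_measurable => // x _; exact: measurable_history.
apply/seteqP; split=> w /=; first by move=> Sw; exists (history k w) => //=; rewrite mem_enum.
by move=> [x /=]; rewrite mem_enum => Sx ->.
Qed.

(** The Markov property is assumed for single paths; summing over all paths in [S] that end in [s]
    extends it to any event about the past. *)
Lemma markov_history k (S : pred {ffun 'I_k.+1 -> 'I_n.+1}) (s t : 'I_n.+1) :
  mu [set w | [/\ S (history k w), X k w = s & X k.+1 w = t]] =
  (mu [set w | S (history k w) /\ X k w = s] * (P s t)%:E)%E.
Proof.
have [mX markov] := XP.
pose S' := [pred x : {ffun 'I_k.+1 -> 'I_n.+1} | S x && (x ord_max == s)].
have S'E w : S' (history k w) <-> S (history k w) /\ X k w = s.
  by rewrite inE ffunE; split=> [/andP[Sw /eqP Xs]|[Sw Xs]]; [split | rewrite Sw Xs eqxx].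
rewrite (_ : [set w | [/\ _, _ & _]] =
    [set w | X k.+1 w = t] `&` [set w | S' (history k w)]); last first.
  apply/seteqP; split=> w /=; first by move=> [? ? ?]; split=> //; exact/S'E.
  by move=> [? /S'E[]].
rewrite (_ : [set w | _ /\ _] = setT `&` [set w | S' (history k w)]); last first.
  by rewrite setTI; apply/seteqP; split=> w /=; [move=> SX; apply/S'E | move/S'E].
rewrite !measure_fibers //; try exact: measurable_history.
rewrite ge0_sume_distrl; last by move=> x _; exact: measure_ge0.
apply: eq_bigr => x /andP[_ /eqP xs].
(* [y] extends the path [x] by the state [t] at time [k.+1]; its later values do not matter. *)
pose y l := if (l <= k)%N then x (inord l) else t.
have yk : y k = s by rewrite /y leqnn -xs; congr (x _); apply/val_inj; rewrite /= inordK.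
have yk1 : y k.+1 = t by rewrite /y ltnn.
have := markov k y; rewrite yk yk1 setTI history_fiber => mky.
rewrite (_ : _ `&` _ = [set w | forall l, (l <= k.+1)%N -> X l w = y l]).
  rewrite mky; congr (mu _ * _)%E; apply/seteqP.
  by split=> w /= wx l lk; move: (wx l lk); rewrite /y lk.
apply/seteqP; split=> w /=.
  move=> [wt wx] l; rewrite leq_eqVlt => /orP[/eqP ->|lk]; first by rewrite yk1.
  by rewrite /y -ltnS lk wx // -ltnS.
move=> wy; split; first by rewrite wy.
by move=> l lk; rewrite wy ?(leq_trans lk) // /y lk.
Qed.

Variables i j : 'I_n.+1.

(** The powers of this matrix hold the taboo probabilities: moving from one state to another in [k]
    steps without entering [j]. *)
Definition taboo_mx : 'M[R]_n.+1 := \matrix_(u, v) if v == j then 0 else P u v.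

(** The event [T_j > k]. Time 0 is left out because a chain started in [j] must return to it. *)
Definition avoiding (k : nat) : set T :=
  [set w | forall l, (0 < l <= k)%N -> X l w <> j].

Let avoidp k : pred {ffun 'I_k.+1 -> 'I_n.+1} :=
  [pred h : {ffun 'I_k.+1 -> 'I_n.+1} | [forall l : 'I_k.+1, (0 < l)%N ==> (h l != j)]].

Lemma avoidingE k : avoiding k = [set w | avoidp (history k w)].
Proof.
apply/seteqP; split=> w /=.
  move=> wj; apply/forallP => l; apply/implyP => l0; rewrite ffunE; apply/eqP/wj.
  by rewrite l0 -ltnS /=.
move=> /forallP wj l /andP[l0 lk]; have := wj (inord l).
by rewrite ffunE inordK // l0 => /eqP.
Qed.

Lemma measurable_avoiding k : measurable (avoiding k).
Proof. by rewrite avoidingE; exact: measurable_history_pred. Qed.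

Lemma avoiding0 : avoiding 0 = setT.
Proof. by apply/seteqP; split=> w // _ l /= /andP[]; case: l. Qed.

Lemma avoidingS k : avoiding k.+1 = avoiding k `&` [set w | X k.+1 w <> j].
Proof.
apply/seteqP; split=> w /=.
  move=> wj; split=> [l /andP[l0 lk]|]; last by apply: wj; rewrite leqnn.
  by apply: wj; rewrite l0 ltnW.
move=> [wj wk] l /andP[l0]; rewrite leq_eqVlt => /orP[/eqP -> //|lk].
by apply: wj; rewrite l0.
Qed.

Lemma markov_avoiding k (s t : 'I_n.+1) :
  mu ([set w | X 0 w = i] `&` avoiding k `&`
      [set w | X k.+1 w = t] `&` [set w | X k w = s]) =
  (mu ([set w | X 0 w = i] `&` avoiding k `&` [set w | X k w = s]) * (P s t)%:E)%E.
Proof.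
pose S : pred {ffun 'I_k.+1 -> 'I_n.+1} :=
  [pred h : {ffun 'I_k.+1 -> 'I_n.+1} | (h ord0 == i) && avoidp h].
have SE w : S (history k w) <-> X 0 w = i /\ avoiding k w.
  rewrite avoidingE /S /= ffunE; split=> [/andP[/eqP]|[/eqP Xi Sw]] //.
  by apply/andP; split.
rewrite (_ : _ `&` [set w | X k w = s] =
    [set w | [/\ S (history k w), X k w = s & X k.+1 w = t]]); last first.
  apply/seteqP; split=> w /=; first by move=> [[[Xi wj] ?] ?]; split=> //; apply/SE.
  by move=> [/SE[]].
rewrite markov_history; congr (mu _ * _)%E.
apply/seteqP; split=> w /=; first by move=> [/SE[]].
by move=> [[Xi wj] ?]; split=> //; apply/SE.
Qed.

(** Induction on [k], splitting over the state at time [k] and applying the Markov property. For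
    [s = j] at a positive time both sides vanish. *)
Lemma measure_avoiding_end k (s : 'I_n.+1) :
  mu ([set w | X 0 w = i] `&` avoiding k `&` [set w | X k w = s]) =
  (fine (mu [set w | X 0 w = i]) * (taboo_mx ^+ k) i s)%:E.
Proof.
have [mX _] := XP; have mAv := measurable_avoiding.
elim: k s => [|k IH] s.
  rewrite avoiding0 setIT expr0 mxE; case: eqVneq => [<-|/eqP neq_is].
    by rewrite setIid mulr1 fineK // fin_num_measure.
  rewrite mulr0 (_ : _ `&` _ = set0) ?measure0 //.
  by apply/seteqP; split=> w //= [->].
rewrite exprSr mxE avoidingS.
have [->|sj] := eqVneq s j.
  rewrite (_ : _ `&` _ `&` _ = set0); last by apply/seteqP; split=> w //= [[_ []]].
  by rewrite measure0 big1 ?mulr0 // => u _; rewrite mxE eqxx mulr0.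
rewrite (_ : _ `&` _ `&` _ =
    ([set w | X 0 w = i] `&` avoiding k `&` [set w | X k.+1 w = s]) `&`
      [set w | predT (X k w)]); last first.
  apply/seteqP; split=> w /=; first by move=> [[? []]].
  by move=> [[[? ?] ws] _]; split=> //; split=> //; split=> //; rewrite ws; apply/eqP.
rewrite measure_fibers //; last by apply: measurableI => //; apply: measurableI.
under eq_bigr do rewrite markov_avoiding IH -EFinM.
rewrite sumEFin mulr_sumr; congr EFin; apply: eq_bigr => u _.
by rewrite [taboo_mx _ _]mxE (negbTE sj) mulrA.
Qed.

Lemma measure_avoiding k :
  mu (avoiding k `&` [set w | X 0 w = i]) =
  (fine (mu [set w | X 0 w = i]) * (taboo_mx ^+ k *m ones R n) i 0)%:E.
Proof.
have [mX _] := XP; have mAv := measurable_avoiding.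
rewrite (_ : _ `&` _ =
    ([set w | X 0 w = i] `&` avoiding k) `&` [set w | predT (X k w)]); last first.
  by rewrite setIC; apply/seteqP; split=> w //= [].
rewrite measure_fibers //; last exact: measurableI.
under eq_bigr do rewrite measure_avoiding_end.
rewrite sumEFin; congr EFin; rewrite mxE mulr_sumr; apply: eq_bigr => u _.
by rewrite mxE mulr1.
Qed.

(** The tail-sum formula: [T_j] is the sum of the indicators of [T_j > k], pointwise and also when
    [T_j] is infinite. *)
Lemma first_passage_series w :
  first_passage_time R X j w = (\sum_(0 <= k <oo) (\1_(avoiding k) w)%:E)%E.
Proof.
have ind0 k : (0 <= (\1_(avoiding k) w : R)%:E)%E by rewrite lee_fin indicE ler0n.
have [hit|nohit] := pselect (exists k, (0 < k)%N && (X k w == j)).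
  (* [K] is the first visit to [j], so exactly the indicators with [k < K] equal 1. *)
  have [K /andP[K_gt0 /eqP XK] Kmin] := ex_minnP hit.
  have indE k : (\1_(avoiding k) w : R) = (k < K)%:R.
    rewrite indicE; congr (nat_of_bool _)%:R; apply/idP/idP; rewrite inE /=.
      move=> wj; rewrite ltnNge; apply/negP => Kk; apply: (wj K) => //.
      by rewrite K_gt0.
    move=> kK l /andP[l0 lk] Xl; have := Kmin l; rewrite l0 Xl eqxx => /(_ isT).
    by rewrite leqNgt (leq_ltn_trans lk).
  rewrite (nneseries_split 0 K); last by move=> k _; exact: ind0.
  rewrite [X in (_ + X)%E]eseries0 ?adde0; last first.
    by move=> k Kk _; rewrite indE ltnNge Kk.
  rewrite add0n big_nat (eq_bigr (fun=> 1%:E)); last first.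
    by move=> k /andP[_ kK]; rewrite indE kK.
  rewrite -big_nat sumEFin big_const_nat subn0 iter_addr addr0.
  apply/eqP; rewrite eq_le; apply/andP; split.
    by apply: ereal_inf_lbound; exists K.
  apply: le_ereal_inf_tmp => _ [k [k0 Xk] <-]; rewrite lee_fin ler_nat.
  by apply: Kmin; rewrite k0 Xk eqxx.
have ind1 k : (\1_(avoiding k) w : R) = 1.
  rewrite indicE mem_set // => l /andP[l0 _] Xl; apply: nohit; exists l.
  by rewrite l0 Xl eqxx.
rewrite /first_passage_time (_ : [set _ | _ in _] = set0); last first.
  apply/seteqP; split=> // x [k [k0 Xk] _]; apply: nohit; exists k.
  by rewrite k0 Xk eqxx.
rewrite ereal_inf0; apply/esym/eq_infty => r.
(* Without a visit every indicator is 1, so the partial sum of length [N > r] exceeds [r]. *)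
pose N := (Num.truncn r).+1.
apply: (@le_trans _ _ (N%:R)%:E); first by rewrite lee_fin ltW // truncnS_gt.
apply: le_trans (nneseries_lim_ge N (fun k _ _ => ind0 k)).
by under eq_bigr do rewrite ind1; rewrite sumEFin big_const_nat subn0 iter_addr addr0.
Qed.

End Hitting.

(** * Solutions of [m = e + Q m] as series *)

Section TabooSeries.
Local Open Scope classical_set_scope.
Variables (R : realType) (n : nat).
Implicit Types (Q : 'M[R]_n.+1) (m : 'cV[R]_n.+1).

(** If the least entry [m_s] were negative, row sums at most 1 would give [(Q m)_s >= m_s], hence
    [m_s >= 1 + m_s]. *)
Lemma taboo_solution_ge0 Q m :
  (forall u v, 0 <= Q u v) -> (forall u, \sum_v Q u v <= 1) ->
  m = ones R n + Q *m m -> forall u, 0 <= m u 0.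
Proof.
move=> Q0 Q1 mE u.
have [s _ smin] := @arg_minP _ _ _ ord0 xpredT (fun v => m v 0) isT.
apply: le_trans (smin u isT); rewrite leNgt; apply/negP => ms.
have : m s 0 = 1 + \sum_v Q s v * m v 0 by rewrite {1}mE !mxE.
apply/eqP; rewrite lt_eqF // ltr_pwDl //.
apply: (@le_trans _ _ (\sum_v Q s v * m s 0)).
  by rewrite -mulr_suml ler_nMl.
by apply: ler_sum => v _; apply: ler_wpM2l => //; exact: smin.
Qed.

(** Iterating the equation telescopes: the partial sums are [m - Q^N m], bounded by [m]. The series
    therefore converges, its terms tend to 0, and they dominate the remainder [Q^N m] up to a
    constant. *)
Lemma taboo_series Q m (u : 'I_n.+1) :
  (forall u v, 0 <= Q u v) -> (forall u, 0 <= m u 0) -> m = ones R n + Q *m m ->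
  series (fun k => (Q ^+ k *m ones R n) u 0) @ \oo --> m u 0.
Proof.
move=> Q0 m0 mE.
have Qk0 k := expmx_ge0 k Q0.
have Qm0 k : 0 <= (Q ^+ k *m m) u 0 by rewrite mxE sumr_ge0 // => z _; rewrite mulr_ge0.
have Qe0 k : 0 <= (Q ^+ k *m ones R n) u 0.
  by rewrite mxE sumr_ge0 // => z _; rewrite mxE mulr1.
set f := (fun k => _).
have sE N : series f N = m u 0 - (Q ^+ N *m m) u 0.
  elim: N => [|N IH]; first by rewrite /series /= big_geq // expr0 mul1mx subrr.
  rewrite seriesSr IH [f N]/f.
  rewrite {2}mE mulmxDr mulmxA -[Q ^+ N *m Q]exprSr [(_ + _ *m m) u 0]mxE.
  by rewrite opprD addrA addrAC addrNK.
have cf : cvgn (series f).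
  apply: nondecreasing_is_cvgn; first by apply: nondecreasing_series => k _ _; exact: Qe0.
  by exists (m u 0) => _ [N _ <-]; rewrite sE lerBlDr lerDl.
have f0 := cvg_series_cvg_0 cf.
rewrite (_ : series f = (fun N => m u 0 - (Q ^+ N *m m) u 0)); last by apply/funext.
rewrite -[X in _ --> X]subr0; apply: cvgB; first exact: cvg_cst.
(* Each entry of [m >= 0] is at most the total [C], so [Q^N m <= C Q^N e]. *)
pose C := \sum_v m v 0.
apply: (@squeeze_cvgr _ _ _ _ (fun=> 0) (fun N => C * f N)).
- apply: nearW => N; rewrite Qm0 /= /f !mxE mulr_sumr; apply: ler_sum => v _.
  rewrite mxE mulr1 mulrC ler_wpM2r // /C (bigD1 v) //= lerDl.
  by apply: sumr_ge0.
- exact: cvg_cst.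
- by rewrite -(mulr0 C); apply: cvgM => //; exact: cvg_cst.
Qed.

End TabooSeries.

(** * From the linear equations to expected passage times *)

Section MeanFirstPassage.
Local Open Scope classical_set_scope.

Lemma mean_first_passage_of_equation (R : realType) (n : nat) (P M : 'M[R]_n.+1) :
  stochastic P ->
  M = ones R n *m (ones R n)^T + P *m (M - diag_part M) ->
  mean_first_passage P M.
Proof.
move=> [P0 P1] ME d T mu X XP i j a0.
have [mX _] := XP.
set Q := taboo_mx P j.
have Q0 u v : 0 <= Q u v by rewrite mxE; case: ifP.
have Q1 u : \sum_v Q u v <= 1.
  by rewrite -(P1 u); apply: ler_sum => v _; rewrite mxE; case: ifP.
(* In column [j], subtracting [M_d] removes only the term [k = j], just as zeroing column [j] of [P]
   does. *)
have mE : col j M = ones R n + Q *m col j M.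
  apply/matrixP => u v; rewrite mxE {1}ME [LHS]mxE [RHS]mxE; congr (_ + _).
    by rewrite mxE big_ord1 !mxE mulr1.
  rewrite !mxE; apply: eq_bigr => k _; rewrite !mxE.
  by case: eqVneq => [->|]; rewrite ?mulr1n ?subrr ?mulr0 ?mul0r ?mulr0n ?subr0.
have m0 := taboo_solution_ge0 Q0 Q1 mE.
rewrite /cond_expectation; set A := [set w | X 0 w = i].
have mA : measurable A by exact: mX.
have afin : mu A \is a fin_num by rewrite fin_num_measure.
under eq_integral do rewrite first_passage_series.
(* The terms are nonnegative, so the tail sum may be integrated termwise. *)
rewrite integral_nneseries //; last first.
- move=> k; apply/measurable_EFinP; apply: measurable_indic.
  exact: measurable_avoiding XP _ _.
have intE k : (\int[mu]_(w in A) (\1_(avoiding X j k) w)%:E =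
    (fine (mu A) * (Q ^+ k *m ones R n) i 0)%:E)%E.
  by rewrite integral_indic //;
    [exact: measure_avoiding XP _ _ _ | exact: measurable_avoiding XP _ _].
under eq_eseriesr do rewrite intE.
have sumE : (\sum_(0 <= k <oo) (fine (mu A) * (Q ^+ k *m ones R n) i 0)%:E =
    (fine (mu A) * M i j)%:E)%E.
  apply/cvg_lim => //.
  rewrite (_ : (fun N => _) =
    EFin \o (fun N => fine (mu A) * series (fun k => (Q ^+ k *m ones R n) i 0) N)).
    apply: cvg_EFin; first exact: nearW.
    have := @taboo_series _ _ _ _ i Q0 m0 mE; rewrite mxE => cM; exact: cvgMl_tmp.
  by apply/funext => N; rewrite /= sumEFin /series /= mulr_sumr.
by rewrite sumE -EFinM mulKf // gt_eqF // fine_gt0 // a0 ltey_eq afin.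
Qed.

End MeanFirstPassage.

Theorem mainTheorem4 (R : realType) (n : nat) (P : 'M[R]_n.+1)
    (P_stochastic : stochastic P) (P_irreducible : irreducible_chain P) :
  let e := ones R n in
  let e1 := basis_vec R (ord0 : 'I_n.+1) in
  let A := 1%:M - P in
  let Rm := Rseq P n.+1 in
  let pi := e1^T - e1^T *m A *m Rm in
  let E := e *m e^T in
  let D := invmx (diag_part (e *m pi)) in
  [/\ forall i : 'I_n.+1, denom P (Rseq P i) i != 0,
      unique (stationary P) pi,
      group_inverse A ((1%:M - e *m pi) *m Rm),
      diag_part (e *m pi) \in unitmx
    & mean_first_passage P ((1%:M - Rm + E *m diag_part Rm) *m D)].
Proof.
split.
- exact: denom_neq0.
- split; first exact: stationary_pi.
  by move=> q /(stationary_unique P_stochastic P_irreducible).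
- exact: group_inverse_Rm.
- exact: diag_part_pi_unit.
- by apply: mean_first_passage_of_equation => //; exact: mean_passage_equation.
Qed.
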